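(* Let $n\in\mathbb{N}\setminus\{0\}$ and, for each $i\in\{1,\dots,n\}$, let $(X_i,d_i,W_i,\pi_i)$ be a uniformly smooth hyperbolic space. Put $X:=\prod_{i=1}^n X_i$ and, for $x=(x_1,\dots,x_n)$, $y=(y_1,\dots,y_n)$, $u=(u_1,\dots,u_n)$, $v=(v_1,\dots,v_n)\in X$ and $\lambda\in[0,1]$, define $d(x,y):=\left(\sum_{i=1}^n d_i^2(x_i,y_i)\right)^{1/2}$, $W(x,y,\lambda):=(W_1(x_1,y_1,\lambda),\dots,W_n(x_n,y_n,\lambda))$ and $\pi(\overrightarrow{xy},\overrightarrow{uv}):=\sum_{i=1}^n\pi_i(\overrightarrow{x_iy_i},\overrightarrow{u_iv_i})$. Then $(X,d,W,\pi)$ is a uniformly smooth hyperbolic space.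
   Context: A $W$-hyperbolic space is a triple $(X,d,W)$ where $(X,d)$ is a metric space and $W:X^2\times[0,1]\to X$ is such that, for all $x,y,z,w\in X$ and $\lambda,\mu\in[0,1]$: (W1) $d(z,W(x,y,\lambda))\le(1-\lambda)d(z,x)+\lambda d(z,y)$; (W2) $d(W(x,y,\lambda),W(x,y,\mu))=|\lambda-\mu|d(x,y)$; (W3) $W(x,y,\lambda)=W(y,x,1-\lambda)$; (W4) $d(W(x,z,\lambda),W(y,w,\lambda))\le(1-\lambda)d(x,y)+\lambda d(z,w)$. An ordered pair $(a,b)\in X^2$ is denoted by $\overrightarrow{ab}$, and $d^2(x,y)$ means $(d(x,y))^2$. A smooth hyperbolic space is a quadruple $(X,d,W,\pi)$ where $(X,d,W)$ is a $W$-hyperbolic space and $\pi:X^2\times X^2\to\mathbb{R}$ is such that, for any $x,y,z,u,v\in X$ and $\lambda\in[0,1]$: (P1) $\pi(\overrightarrow{xy},\overrightarrow{xy})=d^2(x,y)$; (P2) $\pi(\overrightarrow{xy},\overrightarrow{uv})=-\pi(\overrightarrow{yx},\overrightarrow{uv})=-\pi(\overrightarrow{xy},\overrightarrow{vu})$; (P3) $\pi(\overrightarrow{xy},\overrightarrow{uv})+\pi(\overrightarrow{yz},\overrightarrow{uv})=\pi(\overrightarrow{xz},\overrightarrow{uv})$; (P4) $\pi(\overrightarrow{xy},\overrightarrow{uv})\le d(x,y)d(u,v)$; (P5) $d^2(W(x,y,\lambda),z)\le(1-\lambda)^2d^2(x,z)+2\lambda\,\pi(\overrightarrow{yz},\overrightarrow{W(x,y,\lambda)z})$.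 A uniformly smooth hyperbolic space is a smooth hyperbolic space $(X,d,W,\pi)$ for which there is a function $\omega:(0,\infty)\times(0,\infty)\to(0,\infty)$ (a modulus of uniform continuity for $\pi$) such that, for any $r,\varepsilon>0$ and $a,u,v,x,y\in X$ with $d(u,a)\le r$, $d(v,a)\le r$ and $d(u,v)\le\omega(r,\varepsilon)$, one has $|\pi(\overrightarrow{xy},\overrightarrow{ua})-\pi(\overrightarrow{xy},\overrightarrow{va})|\le\varepsilon\cdot d(x,y)$. *)

(* Defs.v *)
From mathcomp Require Import all_boot all_order all_algebra.
From mathcomp Require Import reals.

Set Implicit Arguments.
Unset Strict Implicit.
Unset Printing Implicit Defensive.

Import Order.TTheory GRing.Theory Num.Theory.

Local Open Scope ring_scope.

(* Being a metric is a predicate on an explicit distance function, rather than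
   an instance of MathComp-Analysis's metricType: the latter attaches a single
   distance to a carrier, and a product carrier has to be equipped with the
   Euclidean product distance. *)
Record is_metric (R : realType) (X : Type) (d : X -> X -> R) : Prop := {
  metric_ge0 : forall x y, 0 <= d x y;
  metric_eq0 : forall x y, d x y = 0 <-> x = y;
  metric_symm : forall x y, d x y = d y x;
  metric_triangle : forall x y z, d x z <= d x y + d y z
}.

(* W is total in its last argument; only its values for parameters in [0, 1]
   are constrained. *)
Record W_hyperbolic (R : realType) (X : Type) (d : X -> X -> R)
    (W : X -> X -> R -> X) : Prop := {
  W_hyperbolic_metric : is_metric d;
  W_hyperbolic1 : forall (x y z : X) (l : R), 0 <= l <= 1 ->
    d z (W x y l) <= (1 - l) * d z x + l * d z y;
  W_hyperbolic2 : forall (x y : X) (l m : R), 0 <= l <= 1 -> 0 <= m <= 1 ->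
    d (W x y l) (W x y m) = `|l - m| * d x y;
  W_hyperbolic3 : forall (x y : X) (l : R), 0 <= l <= 1 ->
    W x y l = W y x (1 - l);
  W_hyperbolic4 : forall (x y z w : X) (l : R), 0 <= l <= 1 ->
    d (W x z l) (W y w l) <= (1 - l) * d x y + l * d z w
}.

(* The ordered pair written as the vector from a to b is (a, b) : X * X. *)
Record smooth_hyperbolic (R : realType) (X : Type) (d : X -> X -> R)
    (W : X -> X -> R -> X) (pi : X * X -> X * X -> R) : Prop := {
  smooth_hyperbolic_W : W_hyperbolic d W;
  smooth_hyperbolic1 : forall x y : X, pi (x, y) (x, y) = d x y ^+ 2;
  smooth_hyperbolic2 : forall x y u v : X,
    pi (x, y) (u, v) = - pi (y, x) (u, v) /\
    - pi (y, x) (u, v) = - pi (x, y) (v, u);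
  smooth_hyperbolic3 : forall x y z u v : X,
    pi (x, y) (u, v) + pi (y, z) (u, v) = pi (x, z) (u, v);
  smooth_hyperbolic4 : forall x y u v : X,
    pi (x, y) (u, v) <= d x y * d u v;
  smooth_hyperbolic5 : forall (x y z : X) (l : R), 0 <= l <= 1 ->
    d (W x y l) z ^+ 2 <=
      (1 - l) ^+ 2 * d x z ^+ 2 + 2 * l * pi (y, z) (W x y l, z)
}.

(* omega is total; only its values at positive arguments matter. *)
Definition modulus_of_uniform_continuity (R : realType) (X : Type)
    (d : X -> X -> R) (pi : X * X -> X * X -> R) (omega : R -> R -> R) : Prop :=
  forall r e : R, 0 < r -> 0 < e ->
    0 < omega r e /\
    forall a u v x y : X,
      d u a <= r -> d v a <= r -> d u v <= omega r e ->
      `|pi (x, y) (u, a) - pi (x, y) (v, a)| <= e * d x y.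

Definition uniformly_smooth_hyperbolic (R : realType) (X : Type)
    (d : X -> X -> R) (W : X -> X -> R -> X) (pi : X * X -> X * X -> R) : Prop :=
  smooth_hyperbolic d W pi /\
  exists omega : R -> R -> R, modulus_of_uniform_continuity d pi omega.

Definition product_dist (R : realType) (n : nat) (X : 'I_n -> Type)
    (d : forall i, X i -> X i -> R) (x y : forall i, X i) : R :=
  Num.sqrt (\sum_(i < n) d i (x i) (y i) ^+ 2).

Definition product_W (R : realType) (n : nat) (X : 'I_n -> Type)
    (W : forall i, X i -> X i -> R -> X i) (x y : forall i, X i) (l : R) :
    forall i, X i :=
  fun i => W i (x i) (y i) l.

Definition product_pi (R : realType) (n : nat) (X : 'I_n -> Type)
    (pi : forall i, X i * X i -> X i * X i -> R)
    (p q : (forall i, X i) * (forall i, X i)) : R :=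
  \sum_(i < n) pi i (p.1 i, p.2 i) (q.1 i, q.2 i).

(* Main.v *)
Require Import Defs.
From mathcomp Require Import all_boot all_order all_algebra.
From mathcomp Require Import boolp reals.
From mathcomp Require Import ring lra.

(** Every axiom for the product holds because the corresponding axiom holds in
    each factor and the coordinatewise statements can be added up. For (P1),
    (P2), (P3) and (P5), which involve only squared distances and values of
    [pi], summing over the coordinates is enough. The axioms on the distance
    itself, namely the triangle inequality, (W1), (W2) and (W4), say that the
    vector of coordinate distances is dominated by (or equal to) a nonnegative
    combination of other such vectors, so that they follow from monotonicity,
    homogeneity and Minkowski's inequality for the Euclidean norm
    ([l2norm_dominated], [l2normZ]). Axiom (P4) follows by summing and
    applying the Cauchy-Schwarz inequality ([cauchy_schwarz]).
    Points of the product are functions of the coordinate, so (W3) and the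
    separation axiom of the metric also use functional extensionality.

    For uniform continuity, the minimum over [i] of [omega_i (r, e / n)] is a
    modulus of uniform continuity for the product: a coordinate distance never
    exceeds the product distance, so every factor contributes at most
    [e / n * d_i (x_i, y_i)], which is at most [e / n * d (x, y)], and there are
    [n] factors. *)

Set Implicit Arguments.
Unset Strict Implicit.
Unset Printing Implicit Defensive.

Import Order.TTheory GRing.Theory Num.Theory.

Local Open Scope ring_scope.

(** The Euclidean norm of a vector given by its coordinate function;
    [product_dist d x y] is by definition the norm of the vector of the
    [d i (x i) (y i)]. *)
Definition l2norm (R : realType) (n : nat) (a : 'I_n -> R) : R :=
  Num.sqrt (\sum_(i < n) a i ^+ 2).

Lemma sumr_sqr_ge0 (R : realType) (n : nat) (a : 'I_n -> R) :
  0 <= \sum_(i < n) a i ^+ 2.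
Proof. by apply: sumr_ge0 => i _; exact: sqr_ge0. Qed.

Lemma l2norm_ge0 (R : realType) (n : nat) (a : 'I_n -> R) : 0 <= l2norm a.
Proof. exact: sqrtr_ge0. Qed.

Lemma sqr_l2norm (R : realType) (n : nat) (a : 'I_n -> R) :
  l2norm a ^+ 2 = \sum_(i < n) a i ^+ 2.
Proof. by rewrite sqr_sqrtr // sumr_sqr_ge0. Qed.

Lemma l2norm_eq0 (R : realType) (n : nat) (a : 'I_n -> R) :
  l2norm a = 0 <-> forall i, a i = 0.
Proof.
split=> [a0 i|a0]; last first.
  by rewrite /l2norm big1 ?sqrtr0 // => i _; rewrite a0 expr0n.
have : \sum_(j < n) a j ^+ 2 = 0 by rewrite -sqr_l2norm a0 expr0n.
move=> /(psumr_eq0P (fun j _ => sqr_ge0 (a j)))/(_ i isT)/eqP.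
by rewrite sqrf_eq0 => /eqP.
Qed.

Lemma coord_le_l2norm (R : realType) (n : nat) (a : 'I_n -> R) (i : 'I_n) :
  a i <= l2norm a.
Proof.
apply: (le_trans (ler_norm _)).
rewrite -sqrtr_sqr ler_wsqrtr // (bigD1 i) //= lerDl.
by apply: sumr_ge0 => j _; exact: sqr_ge0.
Qed.

Lemma l2normZ (R : realType) (n : nat) (c : R) (a : 'I_n -> R) :
  l2norm (fun i => c * a i) = `|c| * l2norm a.
Proof.
rewrite /l2norm -sqrtr_sqr -sqrtrM ?sqr_ge0 // mulr_sumr.
by congr Num.sqrt; apply: eq_bigr => i _; rewrite exprMn.
Qed.

Lemma cauchy_schwarz (R : realType) (n : nat) (a b : 'I_n -> R) :
  \sum_(i < n) a i * b i <= l2norm a * l2norm b.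
Proof.
have := l2norm_ge0 a; rewrite le_eqVlt => /predU1P[/esym A0|A_gt0].
  rewrite A0 mul0r big1 // => i _.
  by move/l2norm_eq0: A0 => ->; rewrite mul0r.
have := l2norm_ge0 b; rewrite le_eqVlt => /predU1P[/esym B0|B_gt0].
  rewrite B0 mulr0 big1 // => i _.
  by move/l2norm_eq0: B0 => ->; rewrite mulr0.
set A := l2norm a in A_gt0 *; set B := l2norm b in B_gt0 *.
(* Sum over i the inequalities 0 <= (a i * B - b i * A) ^+ 2. *)
have AB_gt0 : 0 < 2 * (A * B) by rewrite !mulr_gt0.
rewrite -(ler_pM2l AB_gt0).
have -> : 2 * (A * B) * (A * B)
    = B ^+ 2 * \sum_(i < n) a i ^+ 2 + A ^+ 2 * \sum_(i < n) b i ^+ 2.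
  by rewrite -!sqr_l2norm -/A -/B; ring.
rewrite !mulr_sumr -big_split /=; apply: ler_sum => i _.
by have := sqr_ge0 (a i * B - b i * A); lra.
Qed.

(** Monotonicity and Minkowski's inequality in one statement. *)
Lemma l2norm_dominated (R : realType) (n : nat) (s t : R)
    (a b c : 'I_n -> R) :
  0 <= s -> 0 <= t -> (forall i, 0 <= c i <= s * a i + t * b i) ->
  l2norm c <= s * l2norm a + t * l2norm b.
Proof.
move=> s0 t0 hc.
have rhs_ge0 : 0 <= s * l2norm a + t * l2norm b.
  by rewrite addr_ge0 // mulr_ge0 // l2norm_ge0.
rewrite -(ler_pXn2r (_ : 0 < 2)%N) ?nnegrE ?l2norm_ge0 // sqr_l2norm.
apply: (@le_trans _ _ (\sum_(i < n) (s * a i + t * b i) ^+ 2)).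
  apply: ler_sum => i _; have /andP[c0 cle] := hc i.
  by rewrite ler_pXn2r ?nnegrE // (le_trans c0).
have -> : \sum_(i < n) (s * a i + t * b i) ^+ 2
    = s ^+ 2 * l2norm a ^+ 2 + t ^+ 2 * l2norm b ^+ 2
      + 2 * (s * t) * \sum_(i < n) a i * b i.
  rewrite !sqr_l2norm !mulr_sumr -!big_split /=.
  by apply: eq_bigr => i _; ring.
have -> : (s * l2norm a + t * l2norm b) ^+ 2
    = s ^+ 2 * l2norm a ^+ 2 + t ^+ 2 * l2norm b ^+ 2
      + 2 * (s * t) * (l2norm a * l2norm b) by ring.
by rewrite lerD2l ler_wpM2l ?cauchy_schwarz // !mulr_ge0.
Qed.

Lemma product_is_metric (R : realType) (n : nat) (X : 'I_n -> Type)
    (d : forall i, X i -> X i -> R) :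
  (forall i, is_metric (d i)) -> is_metric (product_dist d).
Proof.
move=> hd; split=> [x y|x y|x y|x y z].
- exact: l2norm_ge0.
- split=> [/l2norm_eq0 h|->].
    by apply: functional_extensionality_dep => i; apply/(metric_eq0 (hd i)).
  by apply/l2norm_eq0 => i; apply/(metric_eq0 (hd i)).
- by congr Num.sqrt; apply: eq_bigr => i _; rewrite (metric_symm (hd i)).
- rewrite -(mul1r (product_dist d x y)) -(mul1r (product_dist d y z)).
  apply: l2norm_dominated => // i.
  by rewrite !mul1r (metric_ge0 (hd i)) (metric_triangle (hd i)).
Qed.

Lemma product_W_hyperbolic (R : realType) (n : nat) (X : 'I_n -> Type)
    (d : forall i, X i -> X i -> R) (W : forall i, X i -> X i -> R -> X i) :
  (forall i, W_hyperbolic (d i) (W i)) ->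
  W_hyperbolic (product_dist d) (product_W W).
Proof.
move=> hW; have hd i := W_hyperbolic_metric (hW i).
split=> [|x y z l hl|x y l m hl hm|x y l hl|x y z w l hl].
- exact: product_is_metric.
- have /andP[l0 l1] := hl; apply: l2norm_dominated => [||i] //.
    by rewrite subr_ge0.
  by rewrite (metric_ge0 (hd i)) (W_hyperbolic1 (hW i)).
- rewrite -[X in X * _]normr_id -l2normZ.
  congr Num.sqrt; apply: eq_bigr => i _.
  by rewrite (W_hyperbolic2 (hW i)).
- apply: functional_extensionality_dep => i.
  exact: (W_hyperbolic3 (hW i)).
- have /andP[l0 l1] := hl; apply: l2norm_dominated => [||i] //.
    by rewrite subr_ge0.
  by rewrite (metric_ge0 (hd i)) (W_hyperbolic4 (hW i)).
Qed.

Lemma product_smooth_hyperbolic (R : realType) (n : nat) (X : 'I_n -> Type)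
    (d : forall i, X i -> X i -> R) (W : forall i, X i -> X i -> R -> X i)
    (pi : forall i, X i * X i -> X i * X i -> R) :
  (forall i, smooth_hyperbolic (d i) (W i) (pi i)) ->
  smooth_hyperbolic (product_dist d) (product_W W) (product_pi pi).
Proof.
move=> hS.
split=> [|x y|x y u v|x y z u v|x y u v|x y z l hl].
- by apply: product_W_hyperbolic => i; exact: smooth_hyperbolic_W (hS i).
- rewrite sqr_l2norm; apply: eq_bigr => i _.
  exact: smooth_hyperbolic1 (hS i) _ _.
- rewrite /product_pi -!sumrN.
  split; apply: eq_bigr => i _ /=;
    by have [] := smooth_hyperbolic2 (hS i) (x i) (y i) (u i) (v i).
- rewrite /product_pi -big_split; apply: eq_bigr => i _.
  exact: smooth_hyperbolic3 (hS i) _ _ _ _ _.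
- apply: le_trans (cauchy_schwarz _ _); apply: ler_sum => i _.
  exact: smooth_hyperbolic4 (hS i) _ _ _ _.
- rewrite !sqr_l2norm !mulr_sumr -big_split; apply: ler_sum => i _.
  exact: smooth_hyperbolic5 (hS i) _ _ _ _ hl.
Qed.

(** The value 1 at which the minimum starts is immaterial: it only makes the
    modulus smaller. *)
Lemma product_modulus (R : realType) (n : nat) (X : 'I_n -> Type)
    (d : forall i, X i -> X i -> R)
    (pi : forall i, X i * X i -> X i * X i -> R)
    (omega : 'I_n -> R -> R -> R) :
  (0 < n)%N ->
  (forall i, modulus_of_uniform_continuity (d i) (pi i) (omega i)) ->
  modulus_of_uniform_continuity (product_dist d) (product_pi pi)
    (fun r e => \big[Num.min/1]_(i < n) omega i r (e / n%:R)).
Proof.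
move=> n_gt0 ho r e r0 e0.
have n0 : 0 < n%:R :> R by rewrite ltr0n.
have en0 : 0 < e / n%:R by rewrite divr_gt0.
split.
  apply/bigmin_gtP; split=> // i _.
  by have [] := ho i r (e / n%:R) r0 en0.
move=> a u v x y ua va uv.
have di (p q : forall i, X i) i : d i (p i) (q i) <= product_dist d p q.
  exact: (coord_le_l2norm (fun i => d i (p i) (q i))).
rewrite /product_pi -sumrB; apply: (le_trans (ler_norm_sum _ _ _)).
have -> : e * product_dist d x y
    = \sum_(i < n) e / n%:R * product_dist d x y.
  rewrite sumr_const card_ord -mulr_natr.
  by field; rewrite gt_eqF.
apply: ler_sum => i _ /=.
apply: le_trans (ler_wpM2l (ltW en0) (di x y i)).
have [_] := ho i r (e / n%:R) r0 en0; apply.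
- exact: le_trans ua.
- exact: le_trans va.
- apply: (le_trans (di u v i)); apply: (le_trans uv).
  exact: bigmin_le_cond.
Qed.

Theorem proposition3p7 (R : realType) (n : nat) (n_gt0 : (0 < n)%N)
    (X : 'I_n -> Type)
    (d : forall i : 'I_n, X i -> X i -> R)
    (W : forall i : 'I_n, X i -> X i -> R -> X i)
    (pi : forall i : 'I_n, X i * X i -> X i * X i -> R)
    (hX : forall i : 'I_n, uniformly_smooth_hyperbolic (d i) (W i) (pi i)) :
  uniformly_smooth_hyperbolic (product_dist d) (product_W W) (product_pi pi).
Proof.
split; first by apply: product_smooth_hyperbolic => i; case: (hX i).
have /choice[omega homega] : forall i, exists omega : R -> R -> R,
    modulus_of_uniform_continuity (d i) (pi i) omega by move=> i; case: (hX i).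
by eexists; exact: product_modulus n_gt0 homega.
Qed.
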